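(* Let $n\geq 3$ and let $C$ be the curve in $\mathbb{R}^{n}$ with vector equation $\hat{\alpha}(t)=\langle t,\,t\log t,\,\dots,\,t(\log t)^{n-1}\rangle$, $t>0$. Let $0<a_{1}<\cdots<a_{n}$ and, for $k=1,\dots,n$, let $O_{k}$ be the osculating hyperplane to $C$ at $t=a_{k}$. Then $O_{1},\dots,O_{n}$ have a unique point of intersection $P=(i_{1},\dots,i_{n})\in\mathbb{R}^{n}$, and, writing $M_{1}(a_{1},\dots,a_{n})=x_1^{-1}(i_1)=i_{1}$ (where $x_1(t)=t$), one has $$M_{1}(a_{1},\dots,a_{n})=(n-1)!\sum_{j=1}^{n}\frac{a_{j}}{\prod_{\substack{i=1\\ i\neq j}}^{n}(\ln a_{j}-\ln a_{i})}.$$ Moreover, for $n=2$ and $0<a<b$, the first coordinate of the point of intersection of the tangent lines at $t=a$ and $t=b$ to the plane curve $\hat{\alpha}(t)=\langle t,\,t\log t\rangle$ is $L(a,b)=\dfrac{b-a}{\ln b-\ln a}$.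
   Context: Both $\log$ and $\ln$ denote the natural logarithm. For functions $f_{1},\dots,f_{m}$ of $t$, $W(f_{1},\dots,f_{m})(t)$ denotes the Wronskian determinant, i.e. the determinant of the $m\times m$ matrix whose entry in row $i$, column $j$ is $f_{j}^{(i-1)}(t)$. Let $x_{k}(t)=t(\log t)^{k-1}$, $k=1,\dots,n$, so that $\hat{\alpha}(t)=\langle x_{1}(t),\dots,x_{n}(t)\rangle$. For $j=1,\dots,n$ let $W_{j,n}(t)=W\big(x_{1}'(t),\dots,x_{j-1}'(t),x_{j+1}'(t),\dots,x_{n}'(t)\big)$ be the Wronskian of the $n-1$ functions $x_i'$ with $i\neq j$, in increasing order of index, and let $\hat{n}(t)=\langle W_{1,n}(t),-W_{2,n}(t),\dots,(-1)^{n+1}W_{n,n}(t)\rangle$. The osculating hyperplane $O_{a}$ to $C$ at $t=a$ is the hyperplane in $\mathbb{R}^{n}$ consisting of all $\hat{x}=\langle x_{1},\dots,x_{n}\rangle\in\mathbb{R}^n$ satisfying $\hat{x}\cdot\hat{n}(a)=\hat{\alpha}(a)\cdot\hat{n}(a)$, defined when $\hat{n}(a)\neq\hat{0}$; $O_{k}$ stands for $O_{a_k}$. *)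

(* Defs.v *)
From HB Require Import structures.
From mathcomp Require Import all_boot all_order all_algebra.
From mathcomp Require Import all_classical all_reals all_analysis.

Set Implicit Arguments.
Unset Strict Implicit.
Unset Printing Implicit Defensive.

Import Order.TTheory GRing.Theory Num.Theory.
Import numFieldNormedType.Exports.

Local Open Scope classical_set_scope.
Local Open Scope ring_scope.

(* Indices are shifted down by one: [tlog k] is x_{k+1}, the coordinate in
   position k of a row vector is the (k+1)-st coordinate.  [ln] is total; only
   values and (local) derivatives at points t > 0 are ever used. *)
Definition tlog {R : realType} (k : nat) (t : R) : R := t * ln t ^+ k.

Definition tlog_curve {R : realType} (n : nat) (t : R) : 'rV[R]_n :=
  \row_(k < n) tlog k t.

Definition wronskian {R : realType} (m : nat) (f : 'I_m -> R -> R) (t : R) : R :=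
  \det (\matrix_(i < m, j < m) ((f j)^`(i))%classic t).

(* [lift j] enumerates increasingly the indices of 'I_n other than j. *)
Definition wronskian_omit {R : realType} (n : nat) (j : 'I_n) (t : R) : R :=
  wronskian (fun i : 'I_n.-1 => ((@tlog R (lift j i))^`())%classic) t.

(* With 0-based j the sign (-1)^(j+1) becomes (-1)^j, so the first one is +. *)
Definition osc_normal {R : realType} (n : nat) (t : R) : 'rV[R]_n :=
  \row_(j < n) ((-1) ^+ j * wronskian_omit j t).

Definition dotrow {R : realType} (n : nat) (p q : 'rV[R]_n) : R :=
  \sum_(k < n) p 0 k * q 0 k.

(* A hyperplane only when [osc_normal n t != 0]. *)
Definition osc_hyperplane {R : realType} (n : nat) (t : R) : set 'rV[R]_n :=
  [set p | dotrow p (osc_normal n t) = dotrow (tlog_curve n t) (osc_normal n t)].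

Definition tangent_line {R : realType} (n : nat) (t : R) : set 'rV[R]_n :=
  [set p | exists s : R,
     p = tlog_curve n t + s *: \row_(k < n) ((@tlog R k)^`())%classic t].

Arguments osc_hyperplane {R} n t _.
Arguments tangent_line {R} n t _.

(* Main.v *)
Require Import Defs.
From HB Require Import structures.
From mathcomp Require Import all_boot all_order all_algebra.
From mathcomp Require Import all_classical all_reals all_analysis.
From mathcomp Require Import ring lra.

Set Implicit Arguments.
Unset Strict Implicit.
Unset Printing Implicit Defensive.

Import Order.TTheory GRing.Theory Num.Theory.
Import numFieldNormedType.Exports.

Local Open Scope classical_set_scope.
Local Open Scope ring_scope.

(** Write d = n - 1 and u = ln t. A linear combination of the coordinates of
    the curve is t q(ln t) for a polynomial q of degree at most d, so everything
    about osculation becomes a statement about jets of q at u.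

    The key is an explicit normal. Let E_k be the Taylor polynomial of degree k
    of the exponential and let m(u) have coordinates
    m_j(u) = (-1)^j / j! E_(d-j)(u). The polynomial q_u with coefficients m_j(u)
    satisfies q_u + q_u' = (u - X)^d / d! and q_u(u) = 1. Since differentiating
    t q(ln t) once gives (q + q')(ln t), and since (u - X)^d has a zero of order
    d at u, the vector m(ln t) is orthogonal to the first d derivatives of the
    curve at t, whereas its product with the position vector is t
    ([dual_coord_annihilates], [dual_coord_curve]). The Wronskian of all the
    coordinates does not vanish, because a polynomial of degree at most d is
    determined by its d-jet; hence the vector of signed Wronskians is a nonzero
    multiple of m(ln t) ([osc_normal_dual]), and the osculating hyperplane at t
    has the equation \sum_j p_j m_j(ln t) = t ([osc_hyperplaneE]).

    To a point p attach the polynomial F_p = \sum_j p_j m_j of degree at most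
    d. As m_j has exact degree d - j, the map p |-> F_p is a bijection onto the
    polynomials of degree at most d, and p lies on all the osculating
    hyperplanes exactly when F_p interpolates exp at the d + 1 distinct nodes
    ln a_k. So the intersection is one point P. The coefficient of degree d of
    F_P is P_0 / d!, and by Lagrange's formula it is the divided difference of
    exp at the nodes ([lead_interpolation]), which is the stated formula.
    Iterating Rolle's theorem on F_P - exp gives P_0 = exp xi for some xi, so
    P_0 is positive ([rolle_poly_expR]).

    In the plane the tangent line at t is y = x (ln t + 1) - t, and two such
    equations are solved directly. *)

(** * Jets of polynomials *)

(** The highest derivative that a polynomial of bounded degree can have is a
    constant, which reads off the top coefficient. *)
Lemma derivn_top (R : nzRingType) (d : nat) (q : {poly R}) :
  (size q <= d.+1)%N -> q^`(d) = (q`_d *+ d`!)%:P.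
Proof.
move=> sq; apply/polyP => -[|i]; rewrite coef_derivn coefC.
  by rewrite addn0 ffactnn.
by rewrite nth_default ?mul0rn// (leq_trans sq)// addnS ltnS leq_addr.
Qed.

Lemma jet_eq0 (R : realFieldType) (q : {poly R}) (u : R) (n : nat) :
  (size q <= n)%N -> (forall i, (i < n)%N -> q^`(i).[u] = 0) -> q = 0.
Proof.
move=> sq q0; apply/eqP; apply/negPn/negP => qn0.
have sq0 : (0 < size q)%N by rewrite size_poly_gt0.
have := q0 (size q).-1; rewrite (leq_trans _ sq) ?prednK// => /(_ isT).
rewrite derivn_top ?prednK// hornerC => /eqP.
by rewrite mulrn_eq0 eqn0Ngt fact_gt0/= -lead_coefE lead_coef_eq0 (negPf qn0).
Qed.

Lemma derivn_expXsubC_root (R : comNzRingType) (c : R) (d l : nat) :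
  (l < d)%N -> (('X - c%:P) ^+ d)^`(l).[c] = 0.
Proof.
elim: l d => [|l IH] [|d]//.
  by rewrite derivn0 horner_exp hornerXsubC subrr expr0n.
rewrite ltnS => ld; rewrite derivSn deriv_exp derivXsubC mul1r derivnMn.
by rewrite hornerMn IH// mul0rn.
Qed.

(** * Derivatives of powers times polynomials in the logarithm *)

(** [logD s i q] is the polynomial g for which the i-th derivative of
    t^s q(ln t) is t^(s-i) g(ln t). *)
Fixpoint logD (R : nzRingType) (s : R) (i : nat) (q : {poly R}) : {poly R} :=
  if i is i'.+1 then (logD s i' q)^`() + (s - i'%:R) *: logD s i' q else q.

Lemma logDD (R : nzRingType) (s : R) i : {morph logD s i : p q / p + q}.
Proof.
by elim: i => //= i IH p q; rewrite IH derivD scalerDr addrACA.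
Qed.

Lemma logDZ (R : comNzRingType) (s : R) i c (q : {poly R}) :
  logD s i (c *: q) = c *: logD s i q.
Proof.
elim: i => //= i IH; rewrite IH derivZ scalerDr !scalerA.
by congr (_ + _ *: _); rewrite mulrC.
Qed.

Lemma logD0 (R : comNzRingType) (s : R) i : logD s i 0 = 0.
Proof. by rewrite -(scale0r 0) logDZ !scale0r. Qed.

Lemma logD_poly (R : comNzRingType) (s : R) i n (c : nat -> R) (u : R) :
  \sum_(k < n) (logD s i 'X^k).[u] * c k = (logD s i (\poly_(k < n) c k)).[u].
Proof.
rewrite poly_def (big_morph _ (logDD s i) (logD0 s i)) horner_sum.
by apply: eq_bigr => k _; rewrite logDZ hornerZ mulrC.
Qed.

(** For s = 1 the first derivative is (q' + q)(ln t), which carries no power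
    of t: the later ones are those of a function with s = 0. *)
Lemma logD1S (R : comNzRingType) i (q : {poly R}) :
  logD 1 i.+1 q = logD 0 i (q^`() + q).
Proof.
elim: i => [|i IH]; first by rewrite /= subr0 scale1r.
rewrite [LHS]/= -/(logD 1 i.+1 q) IH /=.
by rewrite -natr1 opprD addrCA subrr addr0 sub0r.
Qed.

(** [logD s i q] is the i-th derivative of q plus a combination of lower ones,
    so the two families vanish together at a point. Both directions are
    inductions that use only the defining recursion, applied to the l-th
    derivative of [logD s i q] for i + l < n; the triangular coefficients never
    have to be named. *)
Lemma logD_jet_eq0 (R : comNzRingType) (s : R) (q : {poly R}) (u : R) n :
  (forall i, (i < n)%N -> (logD s i q).[u] = 0) <->
  (forall i, (i < n)%N -> q^`(i).[u] = 0).
Proof.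
split=> q0.
- suff H l i : (i + l < n)%N -> (logD s i q)^`(l).[u] = 0.
    by move=> l ln; exact: (H l 0%N ln).
  elim: l i => [|l IH] i il; first by apply: q0; rewrite addn0 in il.
  have := IH i.+1; rewrite addSnnS => /(_ il) /=.
  rewrite derivnD derivnZ -derivSn hornerD hornerZ IH ?mulr0 ?addr0//.
  by rewrite (leq_trans _ il)// addnS.
- suff H i l : (i + l < n)%N -> (logD s i q)^`(l).[u] = 0.
    by move=> i ni; rewrite -(derivn0 (logD s i q)) H ?addn0.
  elim: i l => [|i IH] l il; first exact: q0.
  rewrite /= derivnD derivnZ -derivSn hornerD hornerZ !IH ?mulr0 ?addr0//.
    by rewrite (leq_trans _ il)// addSn.
  by rewrite addnS -addSn.
Qed.

Lemma derivn_tlog (R : realType) (k i : nat) (t : R) : 0 < t ->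
  (tlog k)^`(i)%classic t = t * (t^-1) ^+ i * (logD 1 i 'X^k).[ln t].
Proof.
elim: i t => [|i IH] t t0; first by rewrite derive1n0 expr0 mulr1 /= hornerXn.
rewrite derive1nS derive1E.
pose q : {poly R} := logD 1 i 'X^k.
have t_neq0 : t != 0 by rewrite gt_eqF.
have dq := is_derive1_comp (is_derive_poly q (ln t)) (is_derive1_ln t0).
have dV := is_deriveX i (is_deriveV t_neq0 (is_derive_id t (1 : R))).
have d := is_deriveM (is_deriveM (is_derive_id t (1 : R)) dV) dq.
(* The induction hypothesis holds only at positive points, which suffices
   because derivatives are local. *)
have ne : \near t, (id * [eta GRing.inv] ^+ i * (horner q \o ln (R:=R))) t
    = (tlog k)^`(i)%classic t.
  near=> z; rewrite !fctE IH//=; near: z; exact: lt_nbhsr.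
rewrite -(near_eq_derive _ ne) (@derive_val _ _ _ _ _ _ _ d).
rewrite /= -/q hornerD hornerZ !fctE.
rewrite -exprVn /GRing.scale/=.
case: i {IH ne d dV dq} q => [|i] q; first by field.
rewrite /= !exprS -natr1; field.
Unshelve. all: by end_near.
Qed.

Lemma derivn_tlog_sum (R : realType) (n i : nat) (c : nat -> R) (t : R) :
  0 < t ->
  \sum_(k < n) (tlog k)^`(i)%classic t * c k
    = t * (t^-1) ^+ i * (logD 1 i (\poly_(k < n) c k)).[ln t].
Proof.
move=> t0; rewrite -logD_poly mulr_sumr; apply: eq_bigr => k _.
by rewrite derivn_tlog// mulrA.
Qed.

(** * The dual curve *)

(** The Taylor polynomial of degree k of the exponential at 0. *)
Definition texp (R : fieldType) (k : nat) : {poly R} :=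
  \poly_(i < k.+1) i`!%:R^-1.

(** The coordinates of the dual curve u |-> m(u), whose value at ln t will turn
    out to be normal to the osculating hyperplane at t. They are the
    coefficients of (1 + D)^-1 applied to (u - X)^d / d!, expanded in powers of
    X. *)
Definition dual_coord (R : fieldType) (d j : nat) : {poly R} :=
  ((-1) ^+ j / j`!%:R) *: texp R (d - j).

(** The polynomial in X whose coefficients are the coordinates of the dual
    curve at u. With this encoding, pairing with the derivatives of the curve is
    [derivn_tlog_sum]. *)
Definition dual_poly (R : fieldType) (d : nat) (u : R) : {poly R} :=
  \poly_(j < d.+1) (dual_coord R d j).[u].

Lemma texpS (R : fieldType) (k : nat) (u : R) :
  (texp R k.+1).[u] = (texp R k).[u] + u ^+ k.+1 / k.+1`!%:R.
Proof. by rewrite !horner_poly big_ord_recr /= [_ * u ^+ _]mulrC. Qed.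

(** This equation is what makes the dual curve normal to the derivatives of
    the curve. Coefficientwise it says that E_(k+1) - E_k is the monomial of
    degree k + 1 of the exponential. *)
Lemma dual_polyD (R : numFieldType) (d : nat) (u : R) :
  (dual_poly d u)^`() + dual_poly d u
    = ((-1) ^+ d / d`!%:R) *: ('X - u%:P) ^+ d.
Proof.
have -> : ('X - u%:P) ^+ d
    = \poly_(j < d.+1) ((- u) ^+ (d - j) *+ 'C(d, j)) :> {poly R}.
  rewrite addrC exprDn poly_def; apply: eq_bigr => j _.
  by rewrite -polyCN -polyC_exp mul_polyC scalerMnl.
apply/polyP => j.
rewrite coefD coef_deriv coefZ !coef_poly ltnS.
have fact_neq0 m : m`!%:R != 0 :> R by rewrite pnatr_eq0 -lt0n fact_gt0.
have [jd|dj|<-] := ltngtP j d; last first.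
- rewrite ltnSn mul0rn add0r subnn binn /dual_coord subnn hornerZ horner_poly.
  by rewrite big_ord_recl big_ord0 /= expr0 fact0 invr1 addr0 !mulr1.
- by rewrite ltnS leqNgt dj/= mul0rn mulr0 addr0.
- rewrite ltnS (ltnW jd) /dual_coord -(subnSK jd) !hornerZ texpS.
  set k := (d - j.+1)%N.
  have dE : d = (j + k.+1)%N by rewrite /k subnSK// subnKC// ltnW.
  have bf : 'C(d, j)%:R * (j`!%:R * k.+1`!%:R) = d`!%:R :> R.
    by rewrite -!natrM /k subnSK// bin_fact// ltnW.
  have bn0 : 'C(d, j)%:R != 0 :> R by rewrite pnatr_eq0 -lt0n bin_gt0 ltnW.
  rewrite -(mulr_natr _ j.+1) -(mulr_natr _ 'C(d, j)) -bf.
  have -> : (- u) ^+ k.+1 = (-1) ^+ k.+1 * u ^+ k.+1 by rewrite -exprMn mulN1r.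
  have -> : (-1) ^+ d = (-1) ^+ j * (-1) ^+ k.+1 :> R by rewrite -exprD -dE.
  have sgn : (-1) ^+ k.+1 * (-1) ^+ k.+1 = 1 :> R by rewrite -expr2 sqrr_sign.
  rewrite factS natrM (exprS _ j).
  transitivity ((-1) ^+ j * u ^+ k.+1 / (j`!%:R * k.+1`!%:R) : R).
    by field; rewrite !fact_neq0 nat1r pnatr_eq0.
  rewrite -[LHS]mulr1 -[X in _ * X = _]sgn; move: (_ ^+ k.+1) => s; field.
  by rewrite !fact_neq0 bn0.
Qed.

(** By [dual_polyD] the derivatives of q_u at u of order at most d alternate
    in sign, so the value is decided by the constant d-th derivative. *)
Lemma dual_poly_self (R : numFieldType) (d : nat) (u : R) :
  (dual_poly d u).[u] = 1.
Proof.
have step l : (l <= d)%N ->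
    (dual_poly d u).[u] = (-1) ^+ l * (dual_poly d u)^`(l).[u].
  elim: l => [|l IH] ld; first by rewrite mul1r.
  rewrite (IH (ltnW ld)) exprSr mulrN1 mulNr -mulrN; congr (_ * _).
  apply/eqP; rewrite -addr_eq0 addrC derivSn -hornerD -derivnD dual_polyD.
  by rewrite derivnZ hornerZ derivn_expXsubC_root ?mulr0.
rewrite (step d)// derivn_top ?size_poly// hornerC coef_poly ltnSn.
rewrite /dual_coord subnn hornerZ horner_poly big_ord_recl big_ord0 /=.
rewrite expr0 fact0 invr1 addr0 !mulr1 -[X in _ * X]mulr_natr.
rewrite divfK ?pnatr_eq0 -?lt0n ?fact_gt0//.
by rewrite -expr2 sqrr_sign.
Qed.

Lemma dual_coord_annihilates (R : realType) (d i : nat) (t : R) :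
  0 < t -> (0 < i <= d)%N ->
  \sum_(k < d.+1) (tlog k)^`(i)%classic t * (dual_coord R d k).[ln t] = 0.
Proof.
move=> t0; case: i => // i /= le_id.
pose c k := (dual_coord R d k).[ln t].
apply: etrans (derivn_tlog_sum d.+1 i.+1 c t0) _.
rewrite -/(dual_poly d (ln t)) logD1S.
rewrite (proj2 (logD_jet_eq0 0 _ (ln t) d)) ?mulr0// => l ld.
by rewrite dual_polyD derivnZ hornerZ derivn_expXsubC_root ?mulr0.
Qed.

Lemma dual_coord_curve (R : realType) (d : nat) (t : R) : 0 < t ->
  \sum_(k < d.+1) tlog k t * (dual_coord R d k).[ln t] = t.
Proof.
move=> t0.
have := derivn_tlog_sum d.+1 0 (fun k => (dual_coord R d k).[ln t]) t0.
by rewrite -/(dual_poly d (ln t)) /= dual_poly_self expr0 !mulr1.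
Qed.

(** * Osculating hyperplanes *)

(** The bordered matrix whose minors along the first row are the Wronskians in
    [osc_normal]; with the position vector as border it is the full Wronskian
    matrix of the coordinates. *)
Definition osc_matrix (R : realType) (d : nat) (r : 'rV[R]_d.+1) (t : R) :
    'M[R]_d.+1 :=
  \matrix_(i, j) if i == 0 then r 0 j else (tlog j)^`(i)%classic t.

Lemma cofactor_osc_matrix (R : realType) (d : nat) (r : 'rV[R]_d.+1) (t : R) j :
  cofactor (osc_matrix r t) 0 j = osc_normal d.+1 t 0 j.
Proof.
rewrite /cofactor mxE add0n; congr (_ * \det _).
by apply/matrixP => i k; rewrite !mxE -derive1Sn.
Qed.

Lemma det_osc_matrix (R : realType) (d : nat) (r : 'rV[R]_d.+1) (t : R) :
  \det (osc_matrix r t) = dotrow r (osc_normal d.+1 t).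
Proof.
rewrite (expand_det_row _ 0); apply: eq_bigr => j _.
by rewrite cofactor_osc_matrix mxE eqxx.
Qed.

(** A linear relation among the columns is a polynomial q of degree at most d
    such that t q(ln t) has all its derivatives of order at most d zero at t;
    then q has zero d-jet at ln t. *)
Lemma det_osc_matrix_curve_neq0 (R : realType) (d : nat) (t : R) : 0 < t ->
  \det (osc_matrix (tlog_curve d.+1 t) t) != 0.
Proof.
move=> t0; rewrite -det_tr; apply/det0P => -[v vn0 v0].
pose c k := v 0 (inord k).
have q0 : \poly_(k < d.+1) c k = 0.
  apply: (@jet_eq0 _ _ (ln t) d.+1); first exact: size_poly.
  apply/(logD_jet_eq0 1) => i lt_id.
  have := congr1 (fun w : 'rV_d.+1 => w 0 (Ordinal lt_id)) v0; rewrite !mxE.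
  have tn0 : t * t^-1 ^+ i != 0.
    by rewrite mulf_neq0// ?expf_neq0 ?invr_eq0// gt_eqF.
  move=> s0; apply: (mulfI tn0); rewrite mulr0 -derivn_tlog_sum//.
  rewrite -[RHS]s0; apply: eq_bigr => k _; rewrite !mxE mulrC /c inord_val.
  congr (_ * _); case: ifPn => // /eqP/(congr1 val)/= i0.
  by rewrite i0.
case/eqP: vn0; apply/rowP => j; rewrite mxE.
have := congr1 (fun p : {poly R} => p`_j) q0.
by rewrite coef_poly ltn_ord coef0 /c inord_val.
Qed.

(** Both vectors are orthogonal to the derivatives of the curve. Explicitly,
    the matrix bordered by the curve sends m(ln t) to t times the first basis
    vector, and multiplying by the adjugate turns this into the claim. *)
Lemma osc_normal_dual (R : realType) (d : nat) (t : R) (j : 'I_d.+1) : 0 < t ->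
  osc_normal d.+1 t 0 j
    = \det (osc_matrix (tlog_curve d.+1 t) t) / t * (dual_coord R d j).[ln t].
Proof.
move=> t0; set A := osc_matrix _ t.
pose m : 'cV[R]_d.+1 := \col_k (dual_coord R d k).[ln t].
have Am : A *m m = t *: delta_mx 0 0.
  apply/colP => i; rewrite !mxE eqxx andbT.
  case: (eqVneq i 0) => [->|i0].
    rewrite mulr1 -[RHS](dual_coord_curve d t0).
    by apply: eq_bigr => k _; rewrite !mxE eqxx.
  rewrite mulr0 -[RHS](@dual_coord_annihilates _ d i t)//; last first.
    rewrite lt0n -ltnS ltn_ord andbT.
    by apply: contraNneq i0 => i0; apply/eqP/val_inj.
  by apply: eq_bigr => k _; rewrite !mxE (negPf i0).
have := congr1 (fun w => (\adj A *m w) j 0) Am.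
rewrite mulmxA mul_adj_mx mul_scalar_mx -scalemxAr !mxE.
rewrite (bigD1 0)//= big1 => [|k k0]; last first.
  by rewrite [delta_mx _ _ _ _]mxE (negPf k0) mulr0.
rewrite !mxE eqxx mulr1 addr0 cofactor_osc_matrix => E.
by rewrite mulrAC E [t * _]mulrC mulfK ?gt_eqF// [RHS]mxE.
Qed.

Lemma osc_normal_neq0 (R : realType) (d : nat) (t : R) :
  0 < t -> osc_normal d.+1 t != 0.
Proof.
move=> t0; apply: contraNneq (det_osc_matrix_curve_neq0 d t0) => n0.
by rewrite det_osc_matrix n0 /dotrow big1// => k _; rewrite !mxE mulr0.
Qed.

(** The position vector of the curve pairs with m(ln t) to t, so after the
    common factor is cancelled the equation no longer involves Wronskians. *)
Lemma osc_hyperplaneE (R : realType) (d : nat) (t : R) (p : 'rV[R]_d.+1) :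
  0 < t ->
  osc_hyperplane d.+1 t p <->
  \sum_(j < d.+1) p 0 j * (dual_coord R d j).[ln t] = t.
Proof.
move=> t0; rewrite /osc_hyperplane /= -[X in _ = X <-> _]det_osc_matrix.
set D := \det _.
have Dn0 : D != 0 by exact: det_osc_matrix_curve_neq0.
have -> : dotrow p (osc_normal d.+1 t)
    = D / t * \sum_(j < d.+1) p 0 j * (dual_coord R d j).[ln t].
  by rewrite mulr_sumr; apply: eq_bigr => j _; rewrite osc_normal_dual// mulrCA.
have tn0 : t != 0 by rewrite gt_eqF.
split => [E|->]; last by rewrite divfK.
by apply: (mulfI (_ : D / t != 0)); rewrite ?E ?divfK// mulf_neq0// invr_eq0.
Qed.

(** * Interpolation of the exponential *)

(** In these terms a point lies on the osculating hyperplane at t exactly when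
    its polynomial agrees with exp at ln t. *)
Definition interpolant (R : fieldType) (d : nat) (p : 'rV[R]_d.+1) : {poly R} :=
  \sum_(j < d.+1) p 0 j *: dual_coord R d j.

Lemma horner_interpolant (R : fieldType) (d : nat) (p : 'rV[R]_d.+1) (u : R) :
  (interpolant p).[u] = \sum_(j < d.+1) p 0 j * (dual_coord R d j).[u].
Proof. by rewrite horner_sum; apply: eq_bigr => j _; rewrite hornerZ. Qed.

Lemma size_interpolant (R : fieldType) (d : nat) (p : 'rV[R]_d.+1) :
  (size (interpolant p) <= d.+1)%N.
Proof.
rewrite (leq_trans (size_sum _ _ _))//; apply/bigmax_leqP => j _.
rewrite (leq_trans (size_scale_leq _ _))// (leq_trans (size_scale_leq _ _))//.
by rewrite (leq_trans (size_poly _ _))// ltnS leq_subr.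
Qed.

(** The dual coordinate of index l has degree d - l, so only the indices
    l <= j contribute to the coefficient of degree d - j, and those below j are
    assumed to vanish. This makes p |-> F_p triangular. *)
Lemma coef_interpolant (R : fieldType) (d : nat) (p : 'rV[R]_d.+1)
    (j : 'I_d.+1) :
  (forall l : 'I_d.+1, (l < j)%N -> p 0 l = 0) ->
  (interpolant p)`_(d - j) = p 0 j * ((-1) ^+ j / j`!%:R / (d - j)`!%:R).
Proof.
move=> p0; rewrite coef_sum (bigD1 j)//= big1 ?addr0 => [|l lj].
  by rewrite !coefZ coef_poly ltnSn.
rewrite !coefZ coef_poly; case: (ltngtP l j) lj => [/p0 -> _|jl _|/val_inj ->].
  - by rewrite mul0r.
  - rewrite ltnS leqNgt ltn_sub2l ?mulr0// (leq_trans jl)// -ltnS ltn_ord//.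
  - by rewrite eqxx.
Qed.

Lemma interpolant_eq0 (R : numFieldType) (d : nat) (p : 'rV[R]_d.+1) :
  interpolant p = 0 -> p = 0.
Proof.
move=> F0.
suff H n (j : 'I_d.+1) : (j < n)%N -> p 0 j = 0.
  by apply/rowP => j; rewrite mxE (H d.+1).
elim: n j => // n IH j; rewrite ltnS => jn.
have := coef_interpolant (fun l lj => IH l (leq_trans lj jn)).
rewrite F0 coef0 => /esym/eqP; rewrite mulf_eq0 => /orP[/eqP//|].
by rewrite !mulf_eq0 signr_eq0 !invr_eq0 !pnatr_eq0 !eqn0Ngt !fact_gt0.
Qed.

(** Lagrange's formula: the Lagrange basis polynomials are monic of degree
    n - 1 up to their denominators, so the coefficient of degree n - 1 is the
    divided difference of the values. *)
Lemma lead_interpolation (F : fieldType) (n : nat) (u : 'I_n -> F)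
    (q : {poly F}) :
  injective u -> (size q <= n)%N ->
  q`_n.-1 = \sum_(j < n) q.[u j] / \prod_(i < n | i != j) (u j - u i).
Proof.
move=> u_inj sq.
pose N j : {poly F} := \prod_(i < n | i != j) ('X - (u i)%:P).
have sN j : size (N j) = n.
  rewrite /N -big_filter size_prod_XsubC size_filter -sum1_count sum1_card.
  by rewrite cardC1 card_ord prednK// (leq_trans _ (ltn_ord j)).
have NE j k : (N j).[u k]
    = if k == j then \prod_(i < n | i != j) (u j - u i) else 0.
  rewrite horner_prod; case: eqVneq => [->|kj].
    by apply: eq_bigr => i _; rewrite hornerXsubC.
  by rewrite (bigD1 k)//= hornerXsubC subrr mul0r.
pose c j := q.[u j] / \prod_(i < n | i != j) (u j - u i).
have -> : q = \sum_j c j *: N j.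
  apply/eqP; rewrite -subr_eq0; apply/eqP.
  apply: (@roots_geq_poly_eq0 _ _ [seq u k | k <- enum 'I_n]).
  - apply/allP => _ /mapP[k _ ->]; apply/rootP.
    rewrite hornerD hornerN horner_sum (bigD1 k)//= big1 => [|j jk]; last first.
      by rewrite hornerZ NE eq_sym (negPf jk) mulr0.
    rewrite addr0 hornerZ NE eqxx divfK ?subrr//.
    by apply/prodf_neq0 => i ik; rewrite subr_eq0 (inj_eq u_inj) eq_sym.
  - by rewrite map_inj_uniq ?enum_uniq.
  - rewrite size_map size_enum_ord (leq_trans (size_polyD _ _))//.
    rewrite size_polyN geq_max sq/=.
    rewrite (leq_trans (size_sum _ _ _))//; apply/bigmax_leqP => j _.
    by rewrite (leq_trans (size_scale_leq _ _))// sN.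
rewrite coef_sum; apply: eq_bigr => j _.
rewrite coefZ horner_sum (bigD1 j)//= big1 => [|k kj]; last first.
  by rewrite hornerZ NE eq_sym (negPf kj) mulr0.
rewrite addr0 hornerZ NE eqxx divfK; last first.
  by apply/prodf_neq0 => i ij; rewrite subr_eq0 (inj_eq u_inj) eq_sym.
rewrite -{1}(sN j) -lead_coefE (monicP _) ?mulr1//; exact: monic_prod_XsubC.
Qed.

(** The mean value theorem for divided differences of exp: each application of
    Rolle's theorem to q - exp loses one zero, and differentiation replaces q by
    q' while exp stays the same. *)
Lemma rolle_poly_expR (R : realType) (d : nat) (q : {poly R}) (u : nat -> R) :
  (forall i, (i < d)%N -> u i < u i.+1) ->
  (forall i, (i <= d)%N -> q.[u i] = expR (u i)) ->
  exists xi, q^`(d).[xi] = expR xi.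
Proof.
elim: d q u => [|d IH] q u u_incr qu.
  by exists (u 0%N); rewrite derivn0 qu.
have /choice[c c_prop] i : exists c,
    (i <= d)%N -> [/\ u i < c, c < u i.+1 & q^`().[c] = expR c].
  have [le_id|_] := leqP i d; last by exists 0.
  have dF (x : R) : is_derive x (1 : R) (horner q - expR) (q^`().[x] - expR x).
    exact: is_deriveB.
  have [| | |c] := @Rolle _ (horner q - expR) _ _ (u_incr i le_id).
  - by move=> x _; exact: ex_derive.
  - apply: derivable_within_continuous => x _; exact: ex_derive.
  - by rewrite !fctE !qu ?subrr// ltnW.
  rewrite in_itv /= => /andP[uc cu] d0; exists c => _; split => //.
  apply/eqP; rewrite -subr_eq0 -(@derive_val _ _ _ _ _ _ _ (dF c)).
  by rewrite (@derive_val _ _ _ _ _ _ _ d0).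
have [i lt_id|i le_id|xi] := IH q^`() c; last by exists xi; rewrite derivSn.
  have [_ h _] := c_prop i (ltnW lt_id).
  have [h' _ _] := c_prop i.+1 lt_id.
  exact: lt_trans h h'.
by have [] := c_prop i le_id.
Qed.

(** * The common point of the osculating hyperplanes *)

Lemma osc_hyperplanes_interpolant (R : realType) (d : nat) (a : 'I_d.+1 -> R)
    (p : 'rV[R]_d.+1) : (forall k, 0 < a k) ->
  (\bigcap_(k in [set: 'I_d.+1]) osc_hyperplane d.+1 (a k)) p <->
  forall k, (interpolant p).[ln (a k)] = a k.
Proof.
move=> a0; split=> [pa k|pa k _].
  by rewrite horner_interpolant; apply/(osc_hyperplaneE _ (a0 k)); exact: pa.
by apply/(osc_hyperplaneE _ (a0 k)); rewrite -horner_interpolant.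
Qed.

(** The interpolation conditions form a square linear system in p; a solution
    of the homogeneous system has an interpolant of degree at most d with d + 1
    roots. *)
Lemma interpolant_exists_unique (R : numFieldType) (d : nat)
    (u b : 'I_d.+1 -> R) : injective u ->
  exists2 P : 'rV[R]_d.+1, (forall k, (interpolant P).[u k] = b k) &
    forall p, (forall k, (interpolant p).[u k] = b k) -> p = P.
Proof.
move=> u_inj.
pose M : 'M[R]_d.+1 := \matrix_(j, k) (dual_coord R d j).[u k].
have ME p : p *m M = \row_k (interpolant p).[u k].
  apply/rowP => k; rewrite !mxE horner_interpolant.
  by apply: eq_bigr => j _; rewrite mxE.
have Mu : M \in unitmx.
  rewrite unitmxE unitfE; apply/det0P => -[v /eqP vn0 vM]; apply: vn0.
  apply: interpolant_eq0.
  apply: (@roots_geq_poly_eq0 _ _ [seq u k | k <- enum 'I_d.+1]).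
  - apply/allP => _ /mapP[k _ ->]; apply/rootP.
    by have := congr1 (fun w : 'rV_d.+1 => w 0 k) vM; rewrite ME !mxE.
  - by rewrite map_inj_uniq ?enum_uniq.
  - by rewrite size_map size_enum_ord size_interpolant.
exists (\row_k b k *m invmx M) => [k|p pb].
  have := congr1 (fun w : 'rV_d.+1 => w 0 k) (ME (\row_k b k *m invmx M)).
  by rewrite mulmxKV// !mxE.
by rewrite -[LHS](mulmxK Mu) ME; congr (_ *m _); apply/rowP => k; rewrite !mxE.
Qed.

Lemma osc_hyperplanes_meet (R : realType) (d : nat) (a : 'I_d.+1 -> R) :
  (forall k, 0 < a k) -> (forall i j : 'I_d.+1, (i < j)%N -> a i < a j) ->
  exists P : 'rV[R]_d.+1,
    [/\ \bigcap_(k in [set: 'I_d.+1]) osc_hyperplane d.+1 (a k) = [set P],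
        0 < P 0 0
      & P 0 0 = d`!%:R *
          \sum_(j < d.+1) a j / \prod_(i < d.+1 | i != j) (ln (a j) - ln (a i))].
Proof.
move=> a0 a_incr.
have u_incr (i j : 'I_d.+1) : (i < j)%N -> ln (a i) < ln (a j).
  by move=> ij; rewrite ltr_ln ?posrE// a_incr.
have u_inj : injective (fun k => ln (a k)).
  move=> i j /= uij; apply: val_inj; case: (ltngtP i j) => // /u_incr;
  by rewrite uij ltxx.
have [P Pa Puniq] := interpolant_exists_unique a u_inj.
have fd0 : d`!%:R != 0 :> R by rewrite pnatr_eq0 -lt0n fact_gt0.
have P0 : P 0 0 = (interpolant P)`_d * d`!%:R.
  have := @coef_interpolant _ d P 0 (fun l l0 => ltac:(by [])).
  by rewrite subn0 fact0 divr1 expr0 mul1r => ->; rewrite divfK.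
exists P; split.
- apply/seteqP; split=> [p /osc_hyperplanes_interpolant pa|_ ->].
    by apply: Puniq; exact: pa.
  by apply/osc_hyperplanes_interpolant.
- pose u k := ln (a (inord k)).
  have [||xi xiE] := @rolle_poly_expR _ d (interpolant P) u.
  + by move=> i lt_id; apply: u_incr; rewrite !inordK// ltnS ltnW.
  + by move=> i le_id; rewrite /u lnK ?posrE// Pa.
  have := expR_gt0 xi.
  by rewrite -xiE derivn_top ?size_interpolant// hornerC -mulr_natr -P0.
- rewrite P0 mulrC (lead_interpolation u_inj (size_interpolant P)).
  by congr (_ * _); apply: eq_bigr => j _; rewrite Pa.
Qed.

(** * Tangent lines in the plane *)

Lemma tangent_line_tlogE (R : realType) (t : R) (p : 'rV[R]_2) : 0 < t ->
  tangent_line 2 t p <-> p 0 1 = p 0 0 * (ln t + 1) - t.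
Proof.
move=> t0.
have D0 : ((@tlog R 0)^`())%classic t = 1.
  by rewrite -derive1n1 derivn_tlog//= expr0 derivC add0r !subr0 scale1r hornerC
    expr1 !mulr1 divff// gt_eqF.
have D1 : ((@tlog R 1)^`())%classic t = ln t + 1.
  rewrite -derive1n1 derivn_tlog//= expr1 derivX subr0 scale1r hornerD hornerX.
  by rewrite hornerC divff ?gt_eqF// mul1r addrC.
split=> [[s ->]|pE].
  by rewrite !mxE D0 D1 /tlog expr0 expr1; ring.
exists (p 0 0 - t); apply/rowP => j; rewrite !mxE.
have : (j == 0) || (j == 1) by case: j => -[|[|]].
by case/orP => /eqP ->; rewrite ?pE /= ?D0 ?D1 /tlog; ring.
Qed.

Theorem theorem2 (R : realType) :
  (forall (n : nat) (hn : (2 < n)%N) (a : 'I_n -> R),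
     (forall k, 0 < a k) ->
     (forall i j : 'I_n, (i < j)%N -> a i < a j) ->
     (forall k, osc_normal n (a k) != 0) /\
     exists (P : 'rV[R]_n) (M1 : R),
       let i1 := P 0 (Ordinal (ltnW (ltnW hn))) in
       [/\ \bigcap_(k in [set: 'I_n]) osc_hyperplane n (a k) = [set P],
           0 < M1, tlog 0 M1 = i1, M1 = i1
         & M1 = (n.-1)`!%:R *
             \sum_(j < n) a j / \prod_(i < n | i != j) (ln (a j) - ln (a i))])
  /\
  (forall a b : R, 0 < a -> a < b ->
     exists Q : 'rV[R]_2,
       tangent_line 2 a `&` tangent_line 2 b = [set Q] /\
       Q 0 0 = (b - a) / (ln b - ln a)).
Proof.
split=> [[//|d] hn a a0 a_incr|a b a0 ab].
  split=> [k|]; first exact: osc_normal_neq0.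
  have [P [PE P0 Pformula]] := osc_hyperplanes_meet a0 a_incr.
  exists P, (P 0 0) => i1.
  have -> : i1 = P 0 0 by congr (P _ _); exact: val_inj.
  by split=> //; rewrite /tlog expr0 mulr1.
have b0 : 0 < b := lt_trans a0 ab.
have lab : ln b - ln a != 0.
  by rewrite subr_eq0 gt_eqF// ltr_ln ?posrE.
pose x := (b - a) / (ln b - ln a).
have xE : x * (ln b - ln a) = b - a by rewrite divfK.
pose Q : 'rV[R]_2 := \row_j if j == 0 then x else x * (ln a + 1) - a.
exists Q; split; last by rewrite mxE.
apply/seteqP; split=> [p []|_ ->].
  move=> /(tangent_line_tlogE _ a0) pa /(tangent_line_tlogE _ b0) pb.
  have p0 : p 0 0 = x.
    apply: (mulIf lab); rewrite xE; move: pb; rewrite pa => pab.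
    lra.
  apply/rowP => j; rewrite mxE.
  have : (j == 0) || (j == 1) by case: j => -[|[|]].
  by case/orP => /eqP ->; rewrite ?eqxx//= -p0.
split.
  by apply/(tangent_line_tlogE _ a0); rewrite !mxE.
apply/(tangent_line_tlogE _ b0); rewrite !mxE /=.
by clearbody x; lra.
Qed.
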